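(* Let $d\in\{1,2,3\}$. Let $G_d$ be the graph with vertex set $\mathbb{Z}^d$ in which $x,y$ are adjacent if and only if $\max_i|x_i-y_i|=1$, and let $G_d^*$ be the graph with vertex set $\mathbb{Z}^d+\tfrac12=\{x\in\mathbb{R}^d : x_i-\tfrac12\in\mathbb{Z}\text{ for all } i\}$ with the same adjacency rule. For $n\ge 0$ let $G_d(n)$ be the subgraph of $G_d$ induced on $\{x\in\mathbb{Z}^d : |\sum_i x_i|\le n\}$ and $G_d^*(n)$ the subgraph of $G_d^*$ induced on $\{x\in\mathbb{Z}^d+\tfrac12 : |\sum_i x_i|\le n\}$. Then: (i) for every integer $n\ge 0$ with $(d,n)\neq(1,0)$, $kG_d(n)\cong G_d^*(n+d/2-1)$; (ii) for every real $n\ge 0$ with $n-d/2\in\mathbb{Z}$ and $(d,n)\neq(1,0)$, $kG_d^*(n)\cong G_d(n+d/2-1)$; (iii) consequently, for every integer $n\ge0$ with $(d,n)\neq(1,0)$, $k^2G_d(n)\cong G_d(n+d-2)$.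
   Context: All graphs are simple and possibly infinite. A clique of a graph $G$ is an inclusion-maximal complete subgraph. The clique graph $kG$ has as vertices the cliques of $G$, two distinct cliques being adjacent if they share at least one vertex. $k^2G=k(kG)$. $\cong$ denotes graph isomorphism. *)

(* Defs.v *)
From HB Require Import structures.
From mathcomp Require Import all_boot all_order all_algebra.
From mathcomp Require Import boolp classical_sets reals.

Set Implicit Arguments.
Unset Strict Implicit.
Unset Printing Implicit Defensive.

Import Order.TTheory GRing.Theory Num.Theory.

Local Open Scope classical_set_scope.
Local Open Scope ring_scope.

Record graph := Graph {
  vertex :> Type;
  adj : vertex -> vertex -> Prop;
  adj_sym : forall x y, adj x y -> adj y x;
  adj_irrefl : forall x, ~ adj x x }.

Definition isomorphic (G H : graph) : Prop :=
  exists2 f : G -> H, bijective f & forall x y, adj (f x) (f y) <-> adj x y.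

Section Induced.
Variables (G : graph) (A : set G).

Definition induced_adj (x y : A) : Prop := adj (val x) (val y).

Fact induced_adj_sym x y : induced_adj x y -> induced_adj y x.
Proof. exact: adj_sym. Qed.

Fact induced_adj_irrefl x : ~ induced_adj x x.
Proof. exact: adj_irrefl. Qed.

Definition induced : graph := Graph induced_adj_sym induced_adj_irrefl.

End Induced.

Section CliqueGraph.
Variable G : graph.

Definition complete (A : set G) : Prop :=
  forall x y, A x -> A y -> x <> y -> adj x y.

Definition clique (A : set G) : Prop :=
  complete A /\ forall B : set G, complete B -> A `<=` B -> B = A.

Definition clique_adj (Q Q' : [set A | clique A]) : Prop :=
  Q <> Q' /\ exists x : G, val Q x /\ val Q' x.

Fact clique_adj_sym Q Q' : clique_adj Q Q' -> clique_adj Q' Q.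
Proof.
by move=> [neq [x [Qx Q'x]]]; split; [move=> /esym | exists x].
Qed.

Fact clique_adj_irrefl Q : ~ clique_adj Q Q.
Proof. by case. Qed.

Definition clique_graph : graph := Graph clique_adj_sym clique_adj_irrefl.

End CliqueGraph.

Section Lattices.
Variables (R : realType) (d : nat).
Implicit Types (x y : 'rV[R]_d) (n : R).

Definition max_adj x y : Prop :=
  \big[Num.max/0]_(i < d) `|x 0 i - y 0 i| = 1.

Fact max_adj_sym x y : max_adj x y -> max_adj y x.
Proof. by rewrite /max_adj => <-; apply: eq_bigr => i _; rewrite distrC. Qed.

Fact max_adj_irrefl x : ~ max_adj x x.
Proof.
rewrite /max_adj (_ : \big[_/_]_(_ < _) _ = 0).
  by apply/eqP; rewrite eq_sym oner_eq0.
by apply: (big_ind (eq^~ 0)) => // [_ _ -> ->|i _];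
  rewrite ?maxxx ?subrr ?normr0.
Qed.

(* Both lattice graphs carry the same adjacency rule, so they are obtained as
   induced subgraphs of one graph on the whole of R^d. *)
Definition max_graph : graph := Graph max_adj_sym max_adj_irrefl.

Definition lattice_graph : graph :=
  @induced max_graph [set x : 'rV[R]_d | forall i, x 0 i \is a Num.int].

Definition half_lattice_graph : graph :=
  @induced max_graph [set x : 'rV[R]_d | forall i, x 0 i - 2^-1 \is a Num.int].

Definition lattice_strip n : graph :=
  @induced lattice_graph
    [set x : lattice_graph | `|\sum_(i < d) (val x : 'rV[R]_d) 0 i| <= n].

Definition half_lattice_strip n : graph :=
  @induced half_lattice_graph
    [set x : half_lattice_graph | `|\sum_(i < d) (val x : 'rV[R]_d) 0 i| <= n].

End Lattices.

Arguments lattice_strip R d n : clear implicits.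
Arguments half_lattice_strip R d n : clear implicits.

(* Main.v *)
(* A set of pairwise adjacent points of an integer lattice lies in a unit cube,
   and the vertices of a unit cube are pairwise adjacent. After translating the
   lattices to Z^d, the strips become {u | lo <= u_1 + ... + u_d <= hi}, and the
   cliques of such a strip are its intersections with the cubes v + {0,1}^d for
   lo - d + 1 <= v_1 + ... + v_d <= hi - 1: the cubes with more than one vertex
   in the strip. Since the vertex sums of every face of a cube form an integer
   interval, such a cube still has a vertex in the strip on each of its 2d
   facets, which makes the intersection maximal and determines v; for d <= 3,
   two touching cubes of this kind also touch inside the strip. *)
Require Import Defs.
From mathcomp Require Import all_boot all_order all_algebra.
From mathcomp Require Import boolp classical_sets reals.
From mathcomp Require Import zify lra.

Set Implicit Arguments.
Unset Strict Implicit.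
Unset Printing Implicit Defensive.

Import Order.TTheory GRing.Theory Num.Theory.

Local Open Scope ring_scope.

(** * Graph isomorphisms and their action on clique graphs *)

Lemma inj_surj_bijective (T U : Type) (f : T -> U) :
  injective f -> (forall y, exists x, f x = y) -> bijective f.
Proof.
move=> injf /choice[g fg].
by exists g => // x; apply: injf; rewrite fg.
Qed.

Lemma isomorphic_sym (G H : graph) : isomorphic G H -> isomorphic H G.
Proof.
case=> f [g fK gK] fadj; exists g; first by exists f.
by move=> x y; rewrite -fadj !gK.
Qed.

Lemma isomorphic_trans (G H K : graph) :
  isomorphic G H -> isomorphic H K -> isomorphic G K.
Proof.
move=> [f bijf fadj] [g bijg gadj]; exists (g \o f); first exact: bij_comp.
by move=> x y; rewrite /= gadj fadj.
Qed.

Definition induced_vertex (G : graph) (A : set G) (x : G) (Ax : A x) :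
  induced A := SigSub (mem_set Ax).
Arguments induced_vertex {G A x} & Ax.

Lemma complete_preimage (G H : graph) (h : G -> H) (A : set H) :
  injective h -> (forall x y, adj (h x) (h y) <-> adj x y) ->
  complete A -> complete (h @^-1` A)%classic.
Proof.
by move=> injh hadj cA x y Ax Ay xy; rewrite -hadj; apply: cA => // /injh.
Qed.

Lemma clique_preimage (G H : graph) (f : G -> H) (g : H -> G) (A : set G) :
  cancel f g -> cancel g f -> (forall x y, adj (f x) (f y) <-> adj x y) ->
  clique A -> clique (g @^-1` A)%classic.
Proof.
move=> fK gK fadj [cA maxA].
have gadj x y : adj (g x) (g y) <-> adj x y by rewrite -fadj !gK.
split=> [|B cB sAB]; first exact: complete_preimage (can_inj gK) gadj cA.
have <- : (f @^-1` B)%classic = A.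
  apply: maxA; first exact: complete_preimage (can_inj fK) fadj cB.
  by move=> x Ax; apply: sAB; rewrite /= fK.
by apply/seteqP; split=> x; rewrite /= gK.
Qed.

Lemma isomorphic_clique_graph (G H : graph) :
  isomorphic G H -> isomorphic (clique_graph G) (clique_graph H).
Proof.
case=> f [g fK gK] fadj.
have gadj x y : adj (g x) (g y) <-> adj x y by rewrite -fadj !gK.
pose F (Q : clique_graph G) : clique_graph H :=
  SigSub (mem_set (clique_preimage fK gK fadj (set_mem (valP Q)))).
pose F' (Q : clique_graph H) : clique_graph G :=
  SigSub (mem_set (clique_preimage gK fK gadj (set_mem (valP Q)))).
have FK : cancel F F'.
  by move=> Q; apply: val_inj; apply/seteqP; split=> x; rewrite /= fK.
have F'K : cancel F' F.
  by move=> Q; apply: val_inj; apply/seteqP; split=> x; rewrite /= gK.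
exists F; first by exists F'.
move=> Q Q'; split=> -[QQ' [x [Qx Q'x]]]; split.
- by move=> eqQ; apply: QQ'; rewrite eqQ.
- by exists (g x).
- by move=> /(can_inj FK).
- by exists (f x); rewrite /= fK.
Qed.

(** * Integer strips and the unit cubes meeting them *)

(** For integer vectors this says that the maximum norm of [u - v] is 1. *)
Definition int_adj d (u v : 'rV[int]_d) : Prop :=
  u <> v /\ forall i, `|u 0 i - v 0 i| <= 1.

Lemma int_adj_sym d (u v : 'rV[int]_d) : int_adj u v -> int_adj v u.
Proof.
by move=> [uv le1]; split=> [/esym //|i]; rewrite distrC.
Qed.

Lemma int_adj_irrefl d (u : 'rV[int]_d) : ~ int_adj u u.
Proof. by case. Qed.

Definition int_graph d : graph := Graph (@int_adj_sym d) (@int_adj_irrefl d).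

Definition coord_sum d (u : 'rV[int]_d) : int := \sum_i u 0 i.

Definition int_strip d (lo hi : int) : graph :=
  @induced (int_graph d) [set u : int_graph d | lo <= coord_sum u <= hi]%classic.

Section IntStrip.
Variable d : nat.
Implicit Types (u v w : 'rV[int]_d) (lo hi : int).

(** A discrete intermediate value argument: raising [k] coordinates of [P] by 1 raises the sum by
    [k], and [k] takes every value from 0 to [#|P|]. The least [k] that reaches [lo] does not pass
    [hi]. *)
Lemma subset_sum lo hi u (P : pred 'I_d) :
  lo <= hi -> coord_sum u <= hi -> lo <= coord_sum u + #|P|%:Z ->
  exists2 e : 'I_d -> bool, (forall i, e i -> P i) &
    lo <= coord_sum (\row_i (u 0 i + (e i)%:Z)) <= hi.
Proof.
move=> lohi uhi ulo.
have [k kP kE] : exists2 k : nat, (k <= #|P|)%N &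
    lo <= coord_sum u + k%:Z <= hi.
  have [?|?] := leP lo (coord_sum u); first by exists 0%N; lia.
  by exists (absz (lo - coord_sum u)); lia.
exists (fun i => i \in take k (enum P)) => [i /mem_take|].
  by rewrite mem_enum.
suff -> : coord_sum (\row_i (u 0 i + (i \in take k (enum P))%:Z)) =
    coord_sum u + k%:Z by [].
rewrite /coord_sum; under eq_bigr do rewrite mxE.
rewrite big_split /=; congr (_ + _).
rewrite -(big_morph Posz PoszD (erefl _)) -big_mkcond /= sum1_card.
have /card_uniqP -> : uniq (take k (enum P)) by rewrite take_uniq ?enum_uniq.
by rewrite size_takel // -cardE.
Qed.

Lemma coord_sum_le u v :
  (forall i, u 0 i <= v 0 i) -> coord_sum u <= coord_sum v.
Proof. by move=> uv; apply: ler_sum. Qed.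

Lemma coord_sum_le_eq u v :
  (forall i, u 0 i <= v 0 i) -> coord_sum v <= coord_sum u -> u = v.
Proof.
move=> uv vu; apply/rowP => i.
have : \sum_i (v 0 i - u 0 i) == 0.
  rewrite sumrB subr_eq0 eq_le; apply/andP; split=> //.
  exact: coord_sum_le.
rewrite psumr_eq0 => [/allP/(_ i)|j _]; last by rewrite subr_ge0.
by rewrite mem_index_enum => /(_ isT); rewrite subr_eq0 => /eqP.
Qed.

Definition in_cube v u : Prop := forall i, v 0 i <= u 0 i <= v 0 i + 1.

Lemma in_cube_adj v u w : in_cube v u -> in_cube v w -> u <> w -> int_adj u w.
Proof. by move=> vu vw uw; split=> // i; have := vu i; have := vw i; lia. Qed.

Lemma complete_in_cube (K : 'rV[int]_d -> Prop) u0 :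
  K u0 -> (forall u w, K u -> K w -> u <> w -> int_adj u w) ->
  exists v, forall u, K u -> in_cube v u.
Proof.
move=> Ku0 cK.
have cK' u w : K u -> K w -> forall i, `|u 0 i - w 0 i| <= 1.
  move=> Ku Kw i; have [->|uw] := EM (u = w); first by rewrite subrr.
  by case: (cK _ _ Ku Kw uw).
(* This corner is the coordinatewise minimum of [K]: within [K] a coordinate drops at most 1 below
   that of [u0]. *)
exists (\row_i (u0 0 i - `[< exists2 u, K u & u 0 i < u0 0 i >]%:Z)) => u Ku i.
rewrite mxE; have := cK' _ _ Ku Ku0 i; case: asboolP => [[w Kw wi]|nK] /=.
  by have := cK' _ _ Ku Kw i; have := cK' _ _ Kw Ku0 i; lia.
suff : ~ (u 0 i < u0 0 i) by lia.
by move=> ui; apply: nK; exists u.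
Qed.

Lemma coord_sum_add1 v : coord_sum (\row_i (v 0 i + 1)) = coord_sum v + d%:Z.
Proof.
rewrite /coord_sum; under eq_bigr do rewrite mxE.
by rewrite big_split /= sumr_const card_ord natz.
Qed.

(** The cubes through [u] have corners [u - 1 + e] with [e] a 0/1 vector, so their corner sums fill
    the interval from [coord_sum u - d] to [coord_sum u]. The last hypothesis makes the target
    interval nonempty. *)
Lemma exists_cube lo hi u : (0 < d)%N -> lo <= coord_sum u <= hi ->
  lo + 2 <= hi + d%:Z ->
  exists2 v, lo - d%:Z + 1 <= coord_sum v <= hi - 1 & in_cube v u.
Proof.
move=> d0 ulohi lohi.
pose b := \row_i (u 0 i - 1) : 'rV[int]_d.
have sb : coord_sum u = coord_sum b + d%:Z.
  by rewrite -coord_sum_add1; congr coord_sum; apply/rowP => i; rewrite !mxE; lia.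
have [||| e _ he] := @subset_sum (lo - d%:Z + 1) (hi - 1) b predT.
- lia.
- lia.
- by rewrite cardT size_enum_ord; lia.
exists (\row_i (b 0 i + (e i)%:Z)) => // i.
by rewrite !mxE; case: (e i) => /=; lia.
Qed.

(** A cube around [K] can have its corner sum out of range only when [K] is at most a single point,
    and then another cube through that point will do. *)
Lemma complete_sub_cube lo hi (K : 'rV[int]_d -> Prop) :
  (0 < d)%N -> lo <= hi -> lo + 2 <= hi + d%:Z ->
  (forall u, K u -> lo <= coord_sum u <= hi) ->
  (forall u w, K u -> K w -> u <> w -> int_adj u w) ->
  exists2 v, lo - d%:Z + 1 <= coord_sum v <= hi - 1 &
    forall u, K u -> in_cube v u.
Proof.
move=> d0 lohi lohid Ks cK.
have sub1 w : lo <= coord_sum w <= hi -> (forall u, K u -> u = w) ->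
    exists2 v, lo - d%:Z + 1 <= coord_sum v <= hi - 1 &
      forall u, K u -> in_cube v u.
  move=> ws Kw; have [v vs vw] := @exists_cube lo hi w d0 ws lohid.
  by exists v => // u /Kw ->.
have [[u0 Ku0]|K0] := EM (exists u, K u); last first.
  (* For empty [K], any point of the strip serves; this one has sum [lo]. *)
  pose w : 'rV[int]_d := \row_i (if i == Ordinal d0 then lo else 0).
  apply: (sub1 w) => [|u Ku]; last by case: K0; exists u.
  rewrite /coord_sum; under eq_bigr do rewrite mxE.
  by rewrite -big_mkcond big_pred1_eq; lia.
have [v Kv] := complete_in_cube Ku0 cK.
(* The cube meets the strip at most in its lowest vertex [v]. *)
have [vhi|vhi] := leP hi (coord_sum v).
  apply: (sub1 u0) => [|u Ku]; first exact: Ks.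
  have Kv_eq w : K w -> v = w.
    move=> Kw; apply: coord_sum_le_eq; last by have := Ks _ Kw; lia.
    by move=> i; have := Kv _ Kw i; lia.
  by rewrite -(Kv_eq _ Ku) -(Kv_eq _ Ku0).
(* The cube meets the strip at most in its highest vertex, [v] plus 1 in every coordinate. *)
have [vlo|vlo] := leP (coord_sum v) (lo - d%:Z).
  apply: (sub1 u0) => [|u Ku]; first exact: Ks.
  have Kv_eq w : K w -> w = \row_i (v 0 i + 1).
    move=> Kw; apply: coord_sum_le_eq => [i|].
      by have := Kv _ Kw i; rewrite mxE; lia.
    by rewrite coord_sum_add1; have := Ks _ Kw; lia.
  by rewrite (Kv_eq _ Ku) -(Kv_eq _ Ku0).
by exists v => //; lia.
Qed.

(** Fixing coordinate [i] leaves [d - 1] free ones, so the facet sums run from [coord_sum v + e] to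
    [coord_sum v + e + d - 1], an interval that meets the strip. *)
Lemma cube_spans lo hi v i (e : bool) : lo <= hi ->
  lo - d%:Z + 1 <= coord_sum v <= hi - 1 ->
  exists u, [/\ lo <= coord_sum u <= hi, in_cube v u & u 0 i = v 0 i + e%:Z].
Proof.
move=> lohi vs.
pose b := \row_j (v 0 j + ((j == i) && e)%:Z) : 'rV[int]_d.
have sb : coord_sum b = coord_sum v + e%:Z.
  rewrite /coord_sum; under eq_bigr do rewrite mxE.
  rewrite big_split /=; congr (_ + _).
  by rewrite (bigD1 i) //= eqxx big1 ?addr0 // => j /negPf ->.
have [||| f fP fs] := @subset_sum lo hi b (predC1 i).
- by [].
- by rewrite sb; case: (e) => /=; lia.
- have := cardC1 i; rewrite card_ord => ->; have := ltn_ord i.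
  by rewrite sb; case: (e) => /=; lia.
exists (\row_j (b 0 j + (f j)%:Z)); split=> // [j|].
- rewrite !mxE; have := fP j; rewrite /=.
  by case: (j == i) (e) (f j) => -[] [] //= fj; try (by have := fj isT); lia.
- have := fP i; rewrite !mxE /= eqxx.
  by case: (f i) => [/(_ isT)|_] //=; rewrite addr0.
Qed.

(* If [p] and [q] count the coordinates where [v] is below, resp. above [w], the
   smallest common vertex has sum [coord_sum v + p = coord_sum w + q]; it stays
   below [hi] since [p + q <= 3] forces [minn p q <= 1]. The lower bound is
   symmetric. *)
Lemma cubes_meet lo hi v w : (d <= 3)%N -> lo <= hi ->
  lo - d%:Z + 1 <= coord_sum v <= hi - 1 ->
  lo - d%:Z + 1 <= coord_sum w <= hi - 1 ->
  (forall i, `|v 0 i - w 0 i| <= 1) ->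
  exists u, [/\ lo <= coord_sum u <= hi, in_cube v u & in_cube w u].
Proof.
move=> d3 lohi vs ws vw.
pose b := \row_i (Num.max (v 0 i) (w 0 i)) : 'rV[int]_d.
pose P : pred 'I_d := [pred i : 'I_d | v 0 i == w 0 i].
pose p := (\sum_(i < d) (v 0%R i < w 0%R i)%R)%N.
pose q := (\sum_(i < d) (w 0%R i < v 0%R i)%R)%N.
have pqP : (p + q + #|P| = d)%N.
  have -> : #|P| = (\sum_i P i)%N by rewrite -sum1_card big_mkcond.
  rewrite -!big_split /= -[RHS]card_ord -sum1_card.
  by apply: eq_bigr => i _; rewrite /P /=; case: ltgtP.
have bv : coord_sum b = coord_sum v + p%:Z.
  rewrite /coord_sum /p (big_morph Posz PoszD (erefl _)) -big_split /=.
  by apply: eq_bigr => i _; rewrite mxE; have := vw i; lia.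
have bw : coord_sum b = coord_sum w + q%:Z.
  rewrite /coord_sum /q (big_morph Posz PoszD (erefl _)) -big_split /=.
  by apply: eq_bigr => i _; rewrite mxE; have := vw i; lia.
have [||| f fP fs] := @subset_sum lo hi b P; [lia|lia|lia|].
exists (\row_i (b 0 i + (f i)%:Z)); split=> // i; rewrite !mxE;
  have := vw i; have := fP i; case: (f i) => [/(_ isT)|_]; rewrite /P /=; lia.
Qed.

End IntStrip.

(** * The cliques of an integer strip *)

Section CliqueIso.
Variables (d : nat) (lo hi : int).
Hypotheses (d0 : (0 < d)%N) (d3 : (d <= 3)%N).
Hypotheses (lohi : lo <= hi) (lohid : lo + 2 <= hi + d%:Z).

Let G := int_strip d lo hi.
Let H := int_strip d (lo - d%:Z + 1) (hi - 1).

Let cube (v : H) : set G := [set u : G | in_cube (val v) (val u)]%classic.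

Let cube_complete v : complete (cube v).
Proof.
move=> x y vx vy xy; apply: (in_cube_adj vx vy).
by move=> /val_inj.
Qed.

Let mkG u (us : lo <= coord_sum u <= hi) : G := induced_vertex us.

Let cube_spansG v i (e : bool) :
  exists2 u : G, cube v u & val u 0 i = val v 0 i + e%:Z.
Proof.
have [u [us vu ui]] := @cube_spans d lo hi (val v) i e lohi (set_mem (valP v)).
by exists (mkG us).
Qed.

Let cube_clique v : clique (cube v).
Proof.
split=> // B cB sub; apply/seteqP; split=> // x Bx i.
have cBi u : cube v u -> `|val x 0 i - val u 0 i| <= 1.
  move=> /sub Bu; have [->|xu] := EM (x = u); first by rewrite subrr.
  by case: (cB _ _ Bx Bu xu).
(* Vertices on both facets in direction [i] confine [x] to within 1 of [v] and of [v + 1] there,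
   hence between them. *)
have [u0 /cBi + u0i] := cube_spansG v i false.
have [u1 /cBi + u1i] := cube_spansG v i true.
rewrite u0i u1i; lia.
Qed.

Let cube_inj v w : cube v = cube w -> v = w.
Proof.
move=> vw; apply: val_inj; apply/rowP => i.
have [u0 + u0i] := cube_spansG v i false.
have [u1 + u1i] := cube_spansG v i true.
by rewrite vw => /(_ i) + /(_ i); lia.
Qed.

Lemma clique_graph_int_strip :
  isomorphic (clique_graph (int_strip d lo hi))
             (int_strip d (lo - d%:Z + 1) (hi - 1)).
Proof.
apply: isomorphic_sym.
pose F (v : H) : clique_graph G := SigSub (mem_set (cube_clique v)).
have F_inj : injective F by move=> v w /(congr1 val)/cube_inj.
exists F.
  apply: inj_surj_bijective => // Q.
  have [cQ maxQ] := set_mem (valP Q).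
  have [||v vs Qv] := @complete_sub_cube d lo hi
      (fun u => exists2 x : G, val Q x & val x = u) d0 lohi lohid.
  - by move=> _ [x _ <-]; apply: (set_mem (valP x)).
  - move=> _ _ [x Qx <-] [y Qy <-] xy.
    by apply: (cQ x y Qx Qy) => eqxy; apply: xy; rewrite eqxy.
  (* The cube's trace is complete and contains the clique [Q], so maximality makes them equal. *)
  exists (induced_vertex vs); apply: val_inj; apply: maxQ => [|x Qx].
    exact: cube_complete.
  by apply: (Qv (val x)); exists x.
move=> v w; split=> [[vw [x [vx wx]]]|[vw vw1]].
  split=> [/val_inj eqvw|i]; first by apply: vw; rewrite eqvw.
  by have := vx i; have := wx i; lia.
split=> [/F_inj eqvw|]; first by apply: vw; rewrite eqvw.
have [u [us vu wu]] := @cubes_meet d lo hi (val v) (val w) d3 lohi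
  (set_mem (valP v)) (set_mem (valP w)) vw1.
by exists (mkG us).
Qed.

End CliqueIso.

(** * Real lattice strips as translated integer strips *)

Section Embedding.
Variables (R : realType) (d : nat).
Implicit Types (u v : 'rV[int]_d) (x y : 'rV[R]_d) (a n : R).

Definition embed a u : 'rV[R]_d := \row_i ((u 0 i)%:~R + a).

Lemma embed_inj a : injective (embed a).
Proof.
move=> u v /rowP uv; apply/rowP => i.
by have := uv i; rewrite !mxE => /addIr/intr_inj.
Qed.

Lemma sum_embed a u :
  \sum_i embed a u 0 i = (coord_sum u)%:~R + d%:R * a.
Proof.
under eq_bigr do rewrite mxE.
by rewrite big_split /= sumr_const card_ord mulr_natl rmorph_sum.
Qed.

Lemma max_adj_embed a u v : max_adj (embed a u) (embed a v) <-> int_adj u v.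
Proof.
have E i : `|embed a u 0 i - embed a v 0 i| = `|u 0 i - v 0 i|%:~R :> R.
  by rewrite !mxE opprD addrACA subrr addr0 -intrB intr_norm.
rewrite /max_adj; under eq_bigr do rewrite E.
split=> [uv1|[uv le1]].
  split=> [uv|i].
    (* If [u = v], all terms vanish and the maximum is its default 0. *)
    suff : (1 : R) <= 0 by rewrite ler10.
    by rewrite -[leLHS]uv1; apply/bigmax_leP; split=> // i _; rewrite uv subrr.
  rewrite -(ler_int R) -[leRHS]uv1.
  exact: (le_bigmax _ (fun i => `|u 0 i - v 0 i|%:~R : R)).
apply/le_anti/andP; split.
  by apply/bigmax_leP; split=> // i _; rewrite (ler_int R _ 1).
have [i uvi] : exists i, u 0 i <> v 0 i.
  by apply: contra_notP uv => /forallNP uv; apply/rowP => i; apply: contrapT.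
apply: le_trans (le_bigmax _ (fun i => `|u 0 i - v 0 i|%:~R : R) i).
by rewrite (ler_int R 1); lia.
Qed.

(** Common form of both kinds of strip, so that one translation lemma serves the two lattices. *)
Definition strip (A : set (max_graph R d)) n : graph :=
  @induced (@induced (max_graph R d) A)
    [set x | `|\sum_(i < d) (val x : 'rV[R]_d) 0 i| <= n]%classic.

Lemma strip_int_strip (A : set (max_graph R d)) a n lo hi :
  (forall x, A x <-> forall i, x 0 i - a \is a Num.int) ->
  lo%:~R = - n - d%:R * a -> hi%:~R = n - d%:R * a ->
  isomorphic (int_strip d lo hi) (strip A n).
Proof.
move=> AE loE hiE.
have Ae u : A (embed a u).
  by apply/AE => i; rewrite mxE addrK intr_int.
have sumE u : (`|\sum_i embed a u 0 i| <= n) = (lo <= coord_sum u <= hi).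
  by rewrite sum_embed -!(ler_int R) loE hiE ler_norml lerBlDr lerBrDr.
have Se u : lo <= coord_sum u <= hi -> `|\sum_i embed a u 0 i| <= n.
  by rewrite sumE.
pose f (u : int_strip d lo hi) : strip A n :=
  induced_vertex (x := induced_vertex (Ae (val u))) (Se _ (set_mem (valP u))).
exists f; last by move=> u v; exact: max_adj_embed.
apply: inj_surj_bijective => [u v /(congr1 (val \o val))/embed_inj/val_inj //|x].
have xA i : (val (val x) : 'rV[R]_d) 0 i - a \is a Num.int.
  by have /AE := set_mem (valP (val x)); apply.
have [u ux] : exists u, embed a u = val (val x).
  exists (\row_i Num.floor ((val (val x) : 'rV[R]_d) 0 i - a)).
  by apply/rowP => i; rewrite !mxE floorK // subrK.
have us : lo <= coord_sum u <= hi.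
  by rewrite -sumE ux; exact: (set_mem (valP x)).
by exists (induced_vertex us); do 2!apply: val_inj.
Qed.

End Embedding.

Theorem theorem2 (R : realType) (d : nat) (hd : d \in [:: 1; 2; 3]%N) :
  [/\ forall n : nat, (d, n) <> (1, 0)%N ->
        isomorphic (clique_graph (lattice_strip R d n%:R))
                   (half_lattice_strip R d (n%:R + d%:R / 2 - 1)),
      forall n : R, 0 <= n -> n - d%:R / 2 \is a Num.int -> (d, n) <> (1%N, 0) ->
        isomorphic (clique_graph (half_lattice_strip R d n))
                   (lattice_strip R d (n + d%:R / 2 - 1))
    & forall n : nat, (d, n) <> (1, 0)%N ->
        isomorphic (clique_graph (clique_graph (lattice_strip R d n%:R)))
                   (lattice_strip R d (n%:R + d%:R - 2))].
Proof.
have [d0 d3] : (0 < d)%N /\ (d <= 3)%N.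
  by move: hd; rewrite !inE => /or3P[] /eqP ->.
have lattice0 (n : R) lo hi : lo%:~R = - n -> hi%:~R = n ->
    isomorphic (int_strip d lo hi) (lattice_strip R d n).
  move=> loE hiE; apply: (@strip_int_strip R d _ 0 n) => [x||].
  - by split=> xA i; have := xA i; rewrite subr0.
  - by rewrite mulr0 subr0.
  - by rewrite mulr0 subr0.
(* The cliques of a half-integer strip are centred at corner + 1, so the corner
   coordinates describe Z^d with offset 1. *)
have lattice1 (n : R) lo hi : lo%:~R = - n - d%:R -> hi%:~R = n - d%:R ->
    isomorphic (int_strip d lo hi) (lattice_strip R d n).
  move=> loE hiE; apply: (@strip_int_strip R d _ 1 n) => [x||].
  - split=> xA i; first exact: rpredB (xA i) (rpred1 _).
    by rewrite -(subrK 1 (x 0 i)); exact: rpredD (xA i) (rpred1 _).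
  - by rewrite mulr1.
  - by rewrite mulr1.
have half (n : R) lo hi : lo%:~R = - n - d%:R / 2 -> hi%:~R = n - d%:R / 2 ->
    isomorphic (int_strip d lo hi) (half_lattice_strip R d n).
  by move=> loE hiE; apply: (@strip_int_strip R d _ 2^-1 n).
(* This is the corner range condition [lo + 2 <= hi + d] for [lo = - n] and [hi = n]. *)
have dn2 (n : nat) : (d, n) <> (1, 0)%N -> (2 <= 2 * n + d)%N.
  move=> dn; have [n0|] := posnP n; last by lia.
  have [d1|] := eqVneq d 1%N; last by lia.
  by case: dn; rewrite n0 d1.
have klattice (n : nat) : (d, n) <> (1, 0)%N ->
    isomorphic (clique_graph (lattice_strip R d n%:R))
               (int_strip d (- n%:Z - d%:Z + 1) (n%:Z - 1)).
  move=> /dn2 nd2.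
  apply: isomorphic_trans (isomorphic_clique_graph (isomorphic_sym _)) _.
    by apply: (lattice0 _ (- n%:Z) n%:Z); rewrite ?rmorphN.
  by apply: clique_graph_int_strip; lia.
split=> [n dn|n n0 nd _|n dn].
- apply: isomorphic_trans (klattice n dn) _.
  apply: half; rewrite ?rmorphB ?rmorphD ?rmorphN ?rmorphB /= ?rmorph1 -!pmulrn;
    lra.
(* With [m = n - d / 2] the half-integer strip becomes the integer strip from [- m - d] to [m]; [md]
   below restates [0 <= n]. *)
- have [m mE] := intrP nd.
  have md : 0 <= 2 * m + d%:Z.
    rewrite -(ler_int R) rmorphD rmorphM /= -mE -!pmulrn; lra.
  apply: isomorphic_trans (isomorphic_clique_graph (isomorphic_sym _)) _.
    apply: (half _ (- m - d%:Z) m); last by rewrite mE.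
    by rewrite rmorphB rmorphN /= -mE -!pmulrn; lra.
  apply: isomorphic_trans (clique_graph_int_strip _ _ _ _) _; [lia|lia|lia|lia|].
  apply: lattice1; rewrite ?rmorphD ?rmorphB ?rmorphN ?rmorph1 /= -?mE -?pmulrn;
    lra.
(* The same inequality now says that the intermediate strip, from [- n - d + 1] to [n - 1], has
   ordered bounds. *)
- have nd2 := dn2 n dn.
  apply: isomorphic_trans (isomorphic_clique_graph (klattice n dn)) _.
  apply: isomorphic_trans (clique_graph_int_strip _ _ _ _) _; [lia|lia|lia|lia|].
  apply: lattice1; rewrite ?rmorphD ?rmorphB ?rmorphD ?rmorphN ?rmorph1 /= -?pmulrn;
    lra.
Qed.
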